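(* Let $\mathcal{H}=\{rrb,rby\}$. Then, as $n\to\infty$, $h_2(n,\mathcal{H})=\Theta(\sqrt{n})$.
   Context: Edge-colorings of the complete graph $K_n$ use colors from $\{r,b,y\}$ (red, blue, yellow); they need not be proper, and not all colors need be used. A pattern is an edge-colored triangle, denoted by the multiset of the colors of its three edges; e.g. $rrb$ is the triangle with two red edges and one blue edge, and $rby$ is the rainbow triangle with one edge of each color. For a family $\mathcal{H}$ of patterns, $\operatorname{Forb}(n,\mathcal{H})$ is the set of all edge-colorings of $K_n$ with colors from $\{r,b,y\}$ in which no triangle has a coloring belonging to $\mathcal{H}$. For an edge-coloring $c$ of $K_n$, $h_2(c)$ is the maximum $k$ such that there is a set of $k$ vertices whose induced edges use at most two of the three colors. Finally, $h_2(n,\mathcal{H})=\min\{h_2(c): c\in\operatorname{Forb}(n,\mathcal{H})\}$. *)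

(* Defs.v *)
From HB Require Import structures.
From mathcomp Require Import all_boot all_order.

Set Implicit Arguments.
Unset Strict Implicit.
Unset Printing Implicit Defensive.

Inductive color : predArgType := Red | Blue | Yellow.

Definition ord_of_color (c : color) : 'I_3 :=
  match c with
  | Red => Ordinal (isT : 0 < 3)
  | Blue => Ordinal (isT : 1 < 3)
  | Yellow => Ordinal (isT : 2 < 3)
  end.

Definition color_of_ord (i : 'I_3) : color :=
  match val i with 0 => Red | 1 => Blue | _ => Yellow end.

Lemma ord_of_colorK : cancel ord_of_color color_of_ord.
Proof. by case. Qed.

HB.instance Definition _ := Finite.copy color (can_type ord_of_colorK).

Definition edge (n : nat) : predArgType := {e : {set 'I_n} | #|e| == 2}.

Definition coloring (n : nat) : predArgType := {ffun edge n -> color}.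

Definition edges_in (n : nat) (S : {set 'I_n}) : {set edge n} :=
  [set e : edge n | val e \subset S].

(* A pattern is a multiset of three colors: a triple taken up to [perm_eq]. *)
Definition pattern : predArgType := 3.-tuple color.

(* The order of the list below is that of [enum], hence irrelevant up to
   [perm_eq]. *)
Definition edge_colors (n : nat) (c : coloring n) (S : {set 'I_n}) :
    seq color :=
  [seq c e | e <- enum (edges_in S)].

Definition has_pattern (n : nat) (c : coloring n) (T : {set 'I_n})
    (p : pattern) : bool :=
  perm_eq (edge_colors c T) p.

Definition Forb (n : nat) (H : seq pattern) : {set coloring n} :=
  [set c : coloring n |
    [forall T : {set 'I_n}, (#|T| == 3) ==> ~~ has (has_pattern c T) H]].

Definition h2_coloring (n : nat) (c : coloring n) : nat :=
  \max_(S : {set 'I_n} | #|c @: edges_in S| <= 2) #|S|.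

(* Since [h2_coloring c <= n] always holds, the neutral value [n] does not
   affect the minimum when [Forb n H] is nonempty; it is the (junk) value
   when [Forb n H] is empty. *)
Definition h2 (n : nat) (H : seq pattern) : nat :=
  \big[Order.min/n]_(c in Forb n H) h2_coloring c.

Definition rrb : pattern := [tuple Red; Red; Blue].
Definition rby : pattern := [tuple Red; Blue; Yellow].

(* Main.v *)
(** Lower bound: in a colouring avoiding [rrb] and [rby], a red edge [uv] and a
    blue edge [uw] force [vw] to be blue.  Hence a red component spans no blue
    edge, and representatives of the red components span no red edge; one of
    these two kinds of two-coloured sets has at least [sqrt n] vertices.

    Upper bound: let [G] be a graph on [m = q ^ 6] vertices without a clique of
    size 14 or an independent set of size [sqrt m = q ^ 3].  Place the vertices
    on pairs [(x, y)] of vertices of [G].  Vertices with the same [x] are joined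
    in yellow when their [y]'s are adjacent in [G] and in red otherwise;
    vertices with distinct [x]'s are joined in yellow when the [x]'s are
    adjacent and in blue otherwise.  A set without red (resp. blue) has at most
    13 vertices per [x] (resp. at most 13 values of [x]), so at most [13 * m]
    elements; a set without yellow has at most [sqrt m * sqrt m = m] elements.
    The graph [G] is a random graph of density [1 / q], with
    [2 * (q - 1) ^ q <= q ^ q] replacing the usual exponential estimate. *)

Require Import Defs.
From mathcomp Require Import all_boot all_order all_algebra zify.

Set Implicit Arguments.
Unset Strict Implicit.
Unset Printing Implicit Defensive.

Import Order.TTheory.

(** * Colours of vertex pairs and forbidden triangles *)

Lemma card_color : #|color| = 3.
Proof.
by rewrite -(card_ord 3); apply: bij_eq_card; exists color_of_ord;
  [exact: ord_of_colorK | case=> [[|[|[|]]]] //= i; apply: val_inj].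
Qed.

Definition pair_color (n : nat) (c : coloring n) (u v : 'I_n) : color :=
  if insub [set u; v] is Some e then c e else Red.

Lemma pair_colorC n (c : coloring n) u v : pair_color c u v = pair_color c v u.
Proof. by rewrite /pair_color setUC. Qed.

Lemma pair_color_diag n (c : coloring n) u : pair_color c u u = Red.
Proof. by rewrite /pair_color insubN // setUid cards1. Qed.

Lemma edgeP n (e : edge n) :
  exists u v : 'I_n, [/\ u != v, val e = [set u; v] &
    forall c : coloring n, pair_color c u v = c e].
Proof.
have /cards2P[u [v [uv eE]]] := valP e.
exists u, v; split=> // c; rewrite /pair_color -eE.
by rewrite (_ : insub (\val e) = Some e) // valK.
Qed.

Lemma edge_exists n (u v : 'I_n) : u != v -> exists e : edge n, val e = [set u; v].
Proof.
move=> uv; have h : #|[set u; v]| == 2 by rewrite cards2 uv.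
by exists (Sub [set u; v] h); rewrite SubK.
Qed.

Lemma pair_colorE n (c : coloring n) (e : edge n) u v :
  val e = [set u; v] -> pair_color c u v = c e.
Proof. by move=> eE; rewrite /pair_color -eE valK. Qed.

Lemma exists_coloring n (g : 'I_n -> 'I_n -> color) :
  (forall u v, g u v = g v u) -> (forall u, g u u = Red) ->
  exists c : coloring n, forall u v, pair_color c u v = g u v.
Proof.
move=> gC gR.
pose c : coloring n := [ffun e : edge n =>
  if [pick p : 'I_n * 'I_n | val e == [set p.1; p.2]] is Some p
  then g p.1 p.2 else Red].
exists c => u v; have [->|uv] := eqVneq u v; first by rewrite pair_color_diag gR.
have [e eE] := edge_exists uv; rewrite (pair_colorE c eE) ffunE.
(* The picked pair may list the endpoints in the opposite order; the symmetry of [g] makes this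
   harmless. *)
case: pickP => [[x y] /= /eqP|/(_ (u, v))]; last by rewrite eE eqxx.
rewrite eE => E.
have := set21 u v; have := set22 u v; rewrite E !inE.
by do 2 ![case/orP => /eqP ?]; subst; rewrite // eqxx in uv.
Qed.

Lemma triple_edge_colors n (c : coloring n) (u v w : 'I_n) :
  u != v -> u != w -> v != w ->
  perm_eq (edge_colors c [set u; v; w])
    [:: pair_color c u v; pair_color c u w; pair_color c v w].
Proof.
move=> uv uw vw.
have [e1 E1] := edge_exists uv; have [e2 E2] := edge_exists uw.
have [e3 E3] := edge_exists vw.
rewrite (pair_colorE c E1) (pair_colorE c E2) (pair_colorE c E3).
suff P : perm_eq (enum (edges_in [set u; v; w])) [:: e1; e2; e3].
  exact: (perm_map c P).
have eqE (e e' : edge n) : (e == e') = (val e == val e') by [].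
apply: uniq_perm; first exact: enum_uniq.
  have d (x : 'I_n) (A B : {set 'I_n}) : x \in A -> x \notin B -> A != B.
    by move=> xA; apply: contraNneq => <-.
  rewrite /= !inE !eqE E1 E2 E3 negb_or !andbT -andbA; apply/and3P; split.
  - by apply: (d v); rewrite !inE ?eqxx ?orbT // negb_or vw eq_sym uv.
  - by apply: (d u); rewrite !inE ?eqxx // negb_or uv uw.
  - by apply: (d u); rewrite !inE ?eqxx // negb_or uv uw.
move=> e; rewrite mem_enum !inE !eqE E1 E2 E3.
apply/idP/idP; last first.
  by case/or3P => /eqP ->; apply/subsetP => x; rewrite !inE;
    case/orP => ->; rewrite ?orbT.
have [x [y [xy -> _]]] := edgeP e; rewrite subUset !sub1set !inE -!orbA.
case/andP=> /or3P[] /eqP ? /or3P[] /eqP ?; subst x y;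
  by rewrite ?eqxx in xy; rewrite ?eqxx // ?orbT // setUC eqxx ?orbT.
Qed.

(* The diagonal convention [pair_color c u u = Red] makes this condition
   vacuous on degenerate triples. *)
Lemma ForbP n (c : coloring n) :
  reflect (forall u v w, pair_color c u v = Red -> pair_color c u w = Blue ->
             pair_color c v w = Blue)
          (c \in Forb n [:: rrb; rby]).
Proof.
rewrite inE; apply: (iffP forallP) => [H u v w uvR uwB|H T].
  have [uv|uv] := eqVneq u v; first by rewrite -uv.
  have uw : u != w by apply/eqP => uw; rewrite uw pair_color_diag in uwB.
  have vw : v != w by apply/eqP => vw; rewrite -vw uvR in uwB.
  have := H [set u; v; w].
  have -> : #|[set u; v; w]| == 3 by rewrite setUC cardsU1 cards2 !inE negb_or uv !(eq_sym w) uw vw.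
  rewrite /= /has_pattern !(permPl (triple_edge_colors c uv uw vw)) uvR uwB.
  by case: (pair_color c v w).
apply/implyP => /eqP T3.
have /card_gt2P[u [v [w [[uT vT wT] [uv vw wu]]]]] : 2 < #|T| by rewrite T3.
have uw : u != w by rewrite eq_sym.
have -> : T = [set u; v; w].
  apply/eqP; rewrite eq_sym eqEcard !subUset !sub1set uT vT wT T3 /=.
  by rewrite setUC cardsU1 cards2 !inE negb_or uv wu (eq_sym w) vw.
rewrite /= /has_pattern !(permPl (triple_edge_colors c uv uw vw)).
(* A triangle is forbidden exactly when it has a red and a blue edge and its third edge is not blue;
   one of the six vertex orders then contradicts [H]. *)
have := (H u v w, H u w v, H v u w, H v w u, H w u v, H w v u).
rewrite !(pair_colorC c v u) !(pair_colorC c w _).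
case: (pair_color c u v); case: (pair_color c u w); case: (pair_color c v w) => //= K;
  case: K => [[[[[k1 k2] k3] k4] k5] k6];
  by [have := k1 erefl erefl | have := k2 erefl erefl | have := k3 erefl erefl
     | have := k4 erefl erefl | have := k5 erefl erefl | have := k6 erefl erefl].
Qed.

(** With three colours in all, using at most two amounts to omitting some colour [k]. *)
Lemma two_colorsP n (c : coloring n) (S : {set 'I_n}) :
  reflect (exists k, {in S &, forall u v, u != v -> pair_color c u v != k})
          (#|c @: edges_in S| <= 2).
Proof.
apply: (iffP idP) => [le2|[k kS]].
  have : c @: edges_in S \proper [set: color].
    rewrite properEcard subsetT cardsT card_color //.
  case/properP => _ [k _ kN]; exists k => u v uS vS uv.
  have [e eE] := edge_exists uv; rewrite (pair_colorE c eE).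
  apply: contraNneq kN => <-; apply: imset_f.
  by rewrite inE eE subUset !sub1set uS vS.
have : c @: edges_in S \subset [set~ k].
  apply/subsetP => _ /imsetP[e + ->]; rewrite !inE.
  have [u [v [uv -> <-]]] := edgeP e.
  by rewrite subUset !sub1set => /andP[uS vS]; apply: kS.
by move/subset_leq_card/leq_trans; apply; rewrite cardsC1 card_color.
Qed.

Lemma card_le_h2_coloring n (c : coloring n) (S : {set 'I_n}) k :
  {in S &, forall u v, u != v -> pair_color c u v != k} ->
  #|S| <= h2_coloring c.
Proof.
move=> kS; apply: (@leq_bigmax_cond _ _ (fun S : {set 'I_n} => #|S|)).
by apply/two_colorsP; exists k.
Qed.

Lemma h2_coloring_le n (c : coloring n) b :
  (forall (S : {set 'I_n}) k,
     {in S &, forall u v, u != v -> pair_color c u v != k} -> #|S| <= b) ->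
  h2_coloring c <= b.
Proof.
by move=> H; apply/bigmax_leqP => S /two_colorsP[k]; apply: H.
Qed.

(** * Lower bound *)

Lemma h2_coloring_lower n (c : coloring n) :
  c \in Forb n [:: rrb; rby] -> n <= h2_coloring c ^ 2.
Proof.
move=> /ForbP cF.
pose red : rel 'I_n := [rel u v | pair_color c u v == Red].
have redC : connect_sym red.
  by apply: sym_connect_sym => u v; rewrite /red /= pair_colorC.
have blue u v w : connect red u v -> pair_color c u w = Blue ->
    pair_color c v w = Blue.
  case/connectP => p + ->; elim: p u => //= x p IH u /andP[/eqP ux xp] uw.
  by apply: (IH x xp); apply: cF ux uw.
(* Carrying a blue edge [uv] along a red path from [u] to [v] would make the diagonal pair [vv]
   blue. *)
have compB u v : connect red u v -> pair_color c u v != Blue.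
  by move=> uv; apply/eqP => /(blue _ _ _ uv); rewrite pair_color_diag.
pose rt := [set r : 'I_n | fingraph.root red r == r].
have rt_le : #|rt| <= h2_coloring c.
  apply: (@card_le_h2_coloring _ _ _ Red) => u v; rewrite !inE => /eqP ru /eqP rv.
  apply: contraNneq => uvR; rewrite -ru -rv.
  by apply/eqP/(fingraph.rootP redC)/connect1; rewrite /red /= uvR.
have comp_le r : #|[set v | fingraph.root red v == r]| <= h2_coloring c.
  apply: (@card_le_h2_coloring _ _ _ Blue) => u v; rewrite !inE => /eqP ru /eqP rv _.
  by apply: compB; apply/(fingraph.rootP redC); rewrite ru rv.
rewrite -[n in n <= _]card_ord -sum1_card.
rewrite (partition_big (fingraph.root red) (mem rt)) /=; last first.
  by move=> v _; rewrite inE root_root.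
apply: (@leq_trans (\sum_(r in rt) h2_coloring c)).
  apply: leq_sum => r _; apply: leq_trans (comp_le r).
  by rewrite -sum1_card; apply/eq_leq/eq_bigl => v; rewrite inE.
by rewrite sum_nat_const expnS expn1 leq_mul2r rt_le orbT.
Qed.

Lemma h2_lower n : n <= h2 n [:: rrb; rby] ^ 2.
Proof.
rewrite /h2; apply: (big_ind (fun k => n <= k ^ 2)).
(* The default value [n] of the minimum satisfies the bound too. *)
- by case: n => // n; rewrite expnS expn1 leq_pmulr.
- by move=> a b; rewrite /Order.min; case: ifP.
- by move=> c; apply: h2_coloring_lower.
Qed.

(** * Random graphs with small cliques and small independent sets *)

(** Cleared of denominators, this is the probability [(#|A| / #|I|) ^ #|D|] that a uniform random
    function maps [D] into [A]. *)
Lemma card_ffun_constrained (T I : finType) (D : {set T}) (A : {set I}) :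
  #|[set f : {ffun T -> I} | [forall x in D, f x \in A]]| * #|I| ^ #|D|
    = #|A| ^ #|D| * #|I| ^ #|T|.
Proof.
pose F (x : T) : pred I := [pred y | (x \in D) ==> (y \in A)].
have -> : #|[set f : {ffun T -> I} | [forall x in D, f x \in A]]|
    = #|(family F : simpl_pred {ffun T -> I})|.
  rewrite cardsE; apply: eq_card => f; rewrite !inE.
  by apply/forallP/familyP => H x; have := H x.
rewrite card_family foldrE big_image /= (bigID (mem D)) /=.
rewrite (eq_bigr (fun=> #|A|)) => [|x xD]; last first.
  by apply: eq_card => y; rewrite !inE xD.
rewrite [X in _ * X * _](eq_bigr (fun=> #|I|)) => [|x /negPf xD]; last first.
  by apply: eq_card => y; rewrite !inE xD.
rewrite !prod_nat_const -mulnA; congr (_ * _); rewrite -expnD.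
by congr (_ ^ _); rewrite addnC -(cardC (mem D)).
Qed.

Lemma card_edges_in n (S : {set 'I_n}) : #|edges_in S| = 'C(#|S|, 2).
Proof.
rewrite -(card_imset _ val_inj) -cards_draws; apply: eq_card => B.
rewrite [RHS]inE; apply/imsetP/andP => [[e + ->]|[BS B2]].
  by rewrite inE => ->; split=> //; exact: (valP e).
by exists (Sub B B2 : edge n); rewrite ?inE SubK.
Qed.

Lemma leq_bin_exp m k : 'C(m, k) <= m ^ k.
Proof.
rewrite (leq_trans (leq_pmulr _ (fact_gt0 k))) // bin_ffact.
by elim: k => [|k IH]; rewrite ?ffactn0 // ffactnSr expnSr leq_mul // leq_subr.
Qed.

(** Union bound over the [k]-subsets, again without denominators: the bad event has probability
    below one half. *)
Lemma card_bad_colorings n q k (A : {set 'I_q}) : 0 < q ->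
  2 * ('C(n, k) * #|A| ^ 'C(k, 2)) < q ^ 'C(k, 2) ->
  2 * #|[set f : {ffun edge n -> 'I_q} |
          [exists S : {set 'I_n}, (#|S| == k) && [forall e in edges_in S, f e \in A]]]|
    < q ^ #|edge n|.
Proof.
move=> q0 lt; set B := [set f | _].
have sub : B \subset \bigcup_(S : {set 'I_n} | #|S| == k)
    [set f : {ffun edge n -> 'I_q} | [forall e in edges_in S, f e \in A]].
  apply/subsetP => f; rewrite inE => /existsP[S /andP[Sk fS]].
  by apply/bigcupP; exists S => //; rewrite inE.
have leB : #|B| * q ^ 'C(k, 2) <= 'C(n, k) * #|A| ^ 'C(k, 2) * q ^ #|edge n|.
  apply: (@leq_trans ((\sum_(S : {set 'I_n} | #|S| == k)
     #|[set f : {ffun edge n -> 'I_q} | [forall e in edges_in S, f e \in A]]|) * q ^ 'C(k, 2))).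
    rewrite leq_mul2r (leq_trans (subset_leq_card sub)) ?orbT //.
    elim/big_rec2: _ => [|S a b _ IH]; first by rewrite cards0.
    by rewrite (leq_trans (leq_card_setU _ _)) // leq_add2l.
  rewrite big_distrl /= (eq_bigr (fun=> #|A| ^ 'C(k, 2) * q ^ #|edge n|)).
    rewrite sum_nat_const mulnA leq_mul2r leq_mul2r.
    by rewrite -[in 'C(n, k)](card_ord n) -card_draws cardsE leqnn !orbT.
  move=> S /eqP Sk.
  by have := card_ffun_constrained (edges_in S) A; rewrite card_edges_in Sk card_ord.
rewrite -(ltn_pmul2r (_ : 0 < q ^ 'C(k, 2))) ?expn_gt0 ?q0 //.
rewrite -mulnA (leq_ltn_trans (leq_mul (leqnn 2) leB)) // mulnA [X in _ < X]mulnC.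
by rewrite ltn_pmul2r // expn_gt0 q0.
Qed.

(* Colour the pairs uniformly with [q] colours and join the pairs of colour 0:
   each kind of bad set occurs with probability below one half. *)
Lemma ramsey_random n q k s : 0 < q ->
  2 * 'C(n, k) < q ^ 'C(k, 2) ->
  2 * ('C(n, s) * q.-1 ^ 'C(s, 2)) < q ^ 'C(s, 2) ->
  exists2 e : rel 'I_n, symmetric e &
    forall S : {set 'I_n},
      ({in S &, forall u v, u != v -> e u v} -> #|S| < k) /\
      ({in S &, forall u v, u != v -> ~~ e u v} -> #|S| < s).
Proof.
move=> q0 hk hs; pose z : 'I_q := Ordinal q0.
have bk := @card_bad_colorings n q k [set z] q0.
have bs := @card_bad_colorings n q s (~: [set z]) q0.
rewrite cards1 exp1n muln1 in bk; rewrite cardsC1 card_ord in bs.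
move/(_ hk): bk; move/(_ hs): bs; set Bs := [set f | _]; set Bk := [set f | _].
move=> bs bk.
have /subsetPn[f _ fN] : ~~ ([set: {ffun edge n -> 'I_q}] \subset Bs :|: Bk).
  apply/negP => /subset_leq_card; rewrite cardsT card_ffun card_ord leqNgt.
  move/negP; apply; rewrite (leq_ltn_trans (leq_card_setU Bs Bk)) //.
  rewrite -(ltn_pmul2l (isT : 0 < 2)) mulnDr [X in _ < X]mul2n -addnn -addSn.
  exact: leq_add bs (ltnW bk).
move: fN; rewrite inE negb_or => /andP[fs fk].
pose e u v := if insub [set u; v] is Some d then f d == z else false.
have eE (d : edge n) u v : val d = [set u; v] -> e u v = (f d == z).
  by move=> dE; rewrite /e -dE valK.
(* Bad events concern sets of exactly [r] vertices, so a larger homogeneous set is first cut down to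
   size [r]. *)
have main b r (S : {set 'I_n}) (A : {set 'I_q}) :
    ~~ [exists S : {set 'I_n}, (#|S| == r) && [forall d in edges_in S, f d \in A]] ->
    (forall x, (x \in A) = ((x == z) == b)) ->
    {in S &, forall u v, u != v -> e u v = b} -> #|S| < r.
  move=> rN AE Sb; rewrite ltnNge; apply: contra rN => rS.
  have [S' S'S S'r] : exists2 S' : {set 'I_n}, S' \subset S & #|S'| = r.
    have : 0 < #|[set B : {set 'I_n} | B \subset S & #|B| == r]|.
      by rewrite cards_draws bin_gt0.
    by case/card_gt0P => S'; rewrite inE => /andP[? /eqP]; exists S'.
  apply/existsP; exists S'; rewrite S'r eqxx /=; apply/'forall_implyP => d.
  rewrite inE; have /cards2P[u [v [uv dE]]] := valP d.
  rewrite dE subUset !sub1set AE -(eE d u v) // => /andP[uS vS].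
  by rewrite (Sb u v) // (subsetP S'S).
exists e => [u v|S]; first by rewrite /e setUC.
rewrite inE in fk; rewrite inE in fs.
split=> HS; [apply: (main true _ _ _ fk)| apply: (main false _ _ _ fs)].
- by move=> x; rewrite inE eqb_id.
- by move=> u v uS vS uv; apply: HS.
- by move=> x; rewrite !inE eqbF_neg.
- by move=> u v uS vS uv; apply/negbTE/HS.
Qed.

Lemma leq_exp a b k : a <= b -> a ^ k <= b ^ k.
Proof. by case: k => // k ab; rewrite leq_exp2r. Qed.

(** With [q = p + 1], keep two terms of the binomial expansion of [(p + 1) ^ (p + 1)]: the second,
    [(p + 1) * p ^ p], is at least [p ^ (p + 1)]. *)
Lemma double_exp_pred q : 0 < q -> 2 * q.-1 ^ q <= q ^ q.
Proof.
case: q => // p _ /=.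
suff H k : p ^ k.+1 + k.+1 * p ^ k <= p.+1 ^ k.+1.
  by apply: leq_trans (H p); rewrite mul2n -addnn leq_add2l expnS leq_mul.
elim: k => [|k IH]; first by rewrite expn1 expn0 muln1 addn1.
rewrite [X in _ <= X]expnS (leq_trans _ (leq_mul (leqnn _) IH)) //.
by rewrite (expnS p k.+1) (expnS p k); move: (p ^ k) => x; nia.
Qed.

(** The exponent [D] contains [E] blocks of length [q], each gaining a factor 2 by
    [double_exp_pred]. *)
Lemma ltn_mul_exp_pred c q E D :
  1 < q -> c < 2 ^ E -> q * E <= D -> c * q.-1 ^ D < q ^ D.
Proof.
move=> q1 cE qED; have p0 : 0 < q.-1 by lia.
rewrite -(subnKC qED) !expnD !expnM mulnA.
apply: (@leq_trans ((2 * q.-1 ^ q) ^ E * q.-1 ^ (D - q * E))).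
  by rewrite expnMn ltn_pmul2r ?ltn_pmul2r ?expn_gt0 ?p0.
apply: leq_mul; last exact/leq_exp/leq_pred.
by apply/leq_exp/double_exp_pred/ltnW.
Qed.

Lemma ramsey_sixth_power q : 13 <= q ->
  exists2 e : rel 'I_(q ^ 6), symmetric e &
    forall S : {set 'I_(q ^ 6)},
      ({in S &, forall u v, u != v -> e u v} -> #|S| < 14) /\
      ({in S &, forall u v, u != v -> ~~ e u v} -> #|S| < q ^ 3).
Proof.
move=> q13; have q0 : 0 < q by lia.
apply: (@ramsey_random _ q) => //.
  (* 14 is the least [k] with ['C(k, 2) > 6 * k]; the cruder bound [q ^ 90] on the binomial still
     leaves a spare factor [q > 2]. *)
  rewrite (_ : 'C(14, 2) = 1 + 6 * 15) // expnD expn1.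
  apply: (@leq_ltn_trans (2 * q ^ (6 * 15))); last by rewrite ltn_pmul2r ?expn_gt0 ?q0 //; lia.
  rewrite leq_mul2l /= (leq_trans (leq_bin_exp _ _)) // -expnM leq_exp2l //; lia.
(* Since [q < 2 ^ q], the binomial is at most [q ^ (6 * q ^ 3) < 2 ^ (6 * q ^ 4)]. The product
   [q * E] is about [6 * q ^ 5] and [D] about [q ^ 6 / 2], hence [13 <= q]. *)
set D := 'C(q ^ 3, 2); pose E := 6 * q ^ 4 + 1.
have qED : q * E <= D.
  rewrite /D bin2 /E geq_half_double -mul2n.
  have -> : q * (6 * q ^ 4 + 1) = 6 * (q ^ 2 * q ^ 3) + q.
    by rewrite mulnDr muln1 mulnCA -expnS -expnD.
  have : 13 * q ^ 2 <= q ^ 3 by rewrite (expnS q 2) leq_mul2r q13 orbT.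
  have : 13 * q <= q ^ 2 by rewrite (expnS q 1) expn1 leq_mul2r q13 orbT.
  move: (q ^ 2) (q ^ 3) q13 => y x; clear=> q13 qy yx.
  have := leq_mul (leqnn x) yx.
  have : x * 2 <= x * y by rewrite leq_mul2l; lia.
  have -> : x * (13 * y) = 13 * (y * x) by rewrite mulnCA (mulnC x).
  by rewrite -subn1 mulnBr (mulnC x y); lia.
have binE : 2 * 'C(q ^ 6, q ^ 3) < 2 ^ E.
  rewrite /E addn1 [X in _ < X]expnS (ltn_pmul2l (isT : 0 < 2)).
  apply: leq_ltn_trans (leq_bin_exp _ _) _.
  have -> : 6 * q ^ 4 = q * (6 * q ^ 3) by rewrite (expnS q 3) mulnCA.
  rewrite -expnM [X in _ < X]expnM ltn_exp2r ?muln_gt0 ?expn_gt0 ?q0 //.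
  exact: ltn_expl.
rewrite mulnA; apply: ltn_mul_exp_pred qED; [lia | exact: binE].
Qed.

(** * The product colouring and the upper bound *)

Lemma card_le_fibers (T I J : finType) (phi : T -> I * J) (S : {set T}) a b :
  injective phi ->
  #|[set (phi v).1 | v in S]| <= a ->
  (forall i, #|[set (phi v).2 | v in S & (phi v).1 == i]| <= b) ->
  #|S| <= a * b.
Proof.
move=> phi_inj Sa Sb.
rewrite -sum1_card (partition_big (fun v => (phi v).1) (mem [set (phi v).1 | v in S])) /=;
  last by move=> v vS; apply: imset_f.
apply: (@leq_trans (\sum_(i in [set (phi v).1 | v in S]) b)); last first.
  by rewrite sum_nat_const leq_mul2r Sa orbT.
apply: leq_sum => i _; apply: leq_trans (Sb i).
rewrite card_in_imset => [|u v]; last first.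
  rewrite !inE => /andP[_ /eqP ui] /andP[_ /eqP vi] E.
  by apply: phi_inj; apply/eqP; rewrite -pair_eqE /pair_eq /= ui vi E !eqxx.
by rewrite -sum1_card; apply/eq_leq/eq_bigl => v; rewrite inE.
Qed.

Lemma h2_le_power n q : 13 <= q -> n <= q ^ 12 ->
  h2 n [:: rrb; rby] <= 13 * q ^ 6.
Proof.
move=> q13 nq; have [e eC eS] := ramsey_sixth_power q13.
have qq : q ^ 3 * q ^ 3 = q ^ 6 by rewrite -expnD.
have le_pair : n <= #|{: 'I_(q ^ 6) * 'I_(q ^ 6)}|.
  by rewrite card_prod !card_ord -expnD.
move: (q ^ 6) qq e eC eS le_pair => m qq e eC eS le_pair {nq}.
pose phi (v : 'I_n) : 'I_m * 'I_m := enum_val (widen_ord le_pair v).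
have phi_inj : injective phi.
  by move=> u v /enum_val_inj /(congr1 val) /= ?; apply: val_inj.
(* The test on second coordinates forces [Red] on the diagonal, as [e] is not known to be
   irreflexive. *)
pose g u v := if (phi u).1 == (phi v).1
  then if ((phi u).2 != (phi v).2) && e (phi u).2 (phi v).2 then Yellow else Red
  else if e (phi u).1 (phi v).1 then Yellow else Blue.
have gC u v : g u v = g v u.
  by rewrite /g ![(phi u).1 == _]eq_sym ![(phi u).2 == _]eq_sym (eC (phi u).2) (eC (phi u).1).
have gR u : g u u = Red by rewrite /g !eqxx.
have [c cE] := exists_coloring gC gR.
(* A red pair shares its first coordinate, and whether a pair is blue depends on first coordinates
   only. *)
have cF : c \in Forb n [:: rrb; rby].
  apply/ForbP => u v w; rewrite !cE /g.
  have [->|_] := eqVneq (phi u).1 (phi v).1; last by case: ifP.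
  by move=> _; case: ifP => // _; case: ifP.
apply: leq_trans (_ : h2_coloring c <= _).
  exact: (@bigmin_le_cond _ _ _ n c (fun c => c \in Forb n [:: rrb; rby])).

apply: h2_coloring_le => S k kS.
have inner (P : rel 'I_m) i :
    {in S &, forall u v, u != v -> (phi u).1 = (phi v).1 -> P (phi u).2 (phi v).2} ->
    {in [set (phi v).2 | v in S & (phi v).1 == i] &, forall x y, x != y -> P x y}.
  move=> PS _ _ /imsetP[u + ->] /imsetP[v + ->]; rewrite !inE.
  move=> /andP[uS /eqP ui] /andP[vS /eqP vi] uv; apply: PS => //; last by rewrite ui.
  by apply: contraNneq uv => ->.
have outer (P : rel 'I_m) :
    {in S &, forall u v, (phi u).1 != (phi v).1 -> P (phi u).1 (phi v).1} ->
    {in [set (phi v).1 | v in S] &, forall x y, x != y -> P x y}.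
  by move=> PS _ _ /imsetP[u uS ->] /imsetP[v vS ->]; apply: PS.
have col u v : u \in S -> v \in S -> u != v -> g u v != k.
  by move=> uS vS uv; rewrite -cE kS.
have neq1 u v : (phi u).1 != (phi v).1 -> u != v by apply: contraNneq => ->.
have neq2 u v : u != v -> (phi u).1 = (phi v).1 -> (phi u).2 != (phi v).2.
  move=> uv E1; apply: contraNneq uv => E2; apply/eqP/phi_inj.
  by rewrite [LHS]surjective_pairing E1 E2 -surjective_pairing.
have le_m (A : {set 'I_m}) : #|A| <= m by rewrite -[m in _ <= m]card_ord max_card.
case: k kS col => _ col.
- rewrite mulnC; apply: card_le_fibers phi_inj _ _ => // i.
  apply: (eS _).1; apply: inner => u v uS vS uv E1.
  by have := col u v uS vS uv; rewrite /g E1 eqxx neq2 //=; case: ifP.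
- apply: card_le_fibers phi_inj _ _ => //.
  apply: (eS _).1; apply: outer => u v uS vS E1.
  by have := col u v uS vS (neq1 _ _ E1); rewrite /g (negPf E1); case: ifP.
- apply: (@leq_trans (q ^ 3 * q ^ 3)); last by rewrite qq leq_pmull.
  apply: card_le_fibers phi_inj _ _ => [|i]; apply/ltnW; apply: (eS _).2.
    apply: (outer [rel x y | ~~ e x y]) => u v uS vS E1 /=.
    by have := col u v uS vS (neq1 _ _ E1); rewrite /g (negPf E1); case: ifP.
  apply: (inner [rel x y | ~~ e x y]) => u v uS vS uv E1 /=.
  by have := col u v uS vS uv; rewrite /g E1 eqxx neq2 //=; case: ifP.
Qed.

(** The number [s] replaces the square root of [n], keeping the estimate in the natural numbers. *)
Lemma h2_upper : exists C, forall n, 0 < n ->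
  exists2 s, s ^ 2 <= n & h2 n [:: rrb; rby] <= C * s.
Proof.
(* For the largest [j] with [j ^ 12 <= n], take [s = j ^ 6] and apply [h2_le_power] with
   [q = j + 13], which is at most [14 * j] because [j] is positive. *)
exists (13 * 14 ^ 6) => n n0.
have ex : exists j, j ^ 12 <= n by exists 0.
have bd j : j ^ 12 <= n -> j <= n.
  by apply: leq_trans; case: j => // j; rewrite expnS leq_pmulr // expn_gt0.
case: (ex_maxnP ex bd) => j jn jmax; exists (j ^ 6); first by rewrite -expnM.
have j0 : 0 < j by apply: jmax; rewrite exp1n.
have nj : n <= (j + 13) ^ 12.
  rewrite leqNgt; apply/negP => /ltnW /jmax; lia.
apply: leq_trans (h2_le_power (leq_addl j 13) nj) _.
rewrite -mulnA leq_mul2l -expnMn; apply/orP; right; apply: leq_exp; lia.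
Qed.

(* Loaded only here because [all_classical] shadows lemmas on finite sets
   such as [setUC]. *)
From mathcomp Require Import all_classical all_reals all_analysis.

Import Order.TTheory GRing.Theory Num.Theory.
Import numFieldNormedType.Exports.
Local Open Scope classical_set_scope.
Local Open Scope ring_scope.

Theorem lemma2p2 (R : realType) :
  (fun n : nat => (h2 n [:: rrb; rby])%:R : R^o)
    \is 'Theta_\oo (fun n : nat => Num.sqrt (n%:R : R) : R^o).
Proof.
have [C hC] := h2_upper.
rewrite bigThetaE eqOmegaO; split; apply/eqO_exP.
  (* The successor makes the constant positive even if [C] is 0. *)
  exists C.+1%:R; first by rewrite ltr0n.
  near=> n; have n0 : (0 < n)%N by near: n; exact: nbhs_infty_gt.
  have [s sn hs] := hC n n0.
  rewrite !ger0_norm ?sqrtr_ge0 ?ler0n // (@le_trans _ _ (C.+1 * s)%:R) //.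
    by rewrite ler_nat (leq_trans hs) // leq_mul2r leqnSn orbT.
  rewrite natrM ler_wpM2l ?ler0n // -[s%:R]ger0_norm ?ler0n // -sqrtr_sqr.
  by rewrite ler_sqrt ?ler0n // -natrX ler_nat.
exists 1 => //; near=> n.
rewrite mul1r !ger0_norm ?sqrtr_ge0 ?ler0n //.
rewrite -[leRHS]ger0_norm ?ler0n // -sqrtr_sqr ler_sqrt ?exprn_ge0 ?ler0n //.
by rewrite -natrX ler_nat h2_lower.
Unshelve. all: by end_near.
Qed.
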